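(* Let $C_1,C_2\in\mathbb{C}$ and $\Psi_1,\Psi_2\in\mathbb{C}[\mathfrak{n}_l]$. Then the $\mathfrak{so}_{2l}(\mathbb{C})$-modules $M_{\mathfrak{n}_l}(C_1,\Psi_1)$ and $M_{\mathfrak{n}_l}(C_2,\Psi_2)$ are isomorphic if and only if $C_1=C_2$ and $\Psi_1-\Psi_2\in\mathbb{C}$.
   Context: Let $l\ge 2$. With $e_{s,t}$ the matrix units of size $2l+1$ and $1\le i,j\le l$, set $X_{i,j}=e_{i+1,j+1}-e_{j+l+1,i+l+1}$, $Y_{i,j}=e_{i+1,j+l+1}-e_{j+1,i+l+1}$, $Z_{i,j}=e_{i+l+1,j+1}-e_{j+l+1,i+1}$; $\mathfrak{so}_{2l}(\mathbb{C})$ is the Lie algebra spanned by all $X_{i,j},Y_{i,j},Z_{i,j}$. Its Chevalley generators are $e_{\alpha_i}=X_{i,i+1}$, $f_{\alpha_i}=X_{i+1,i}$, $h_{\alpha_i}=X_{i,i}-X_{i+1,i+1}$ ($1\le i\le l-1$) and $e_{\alpha'_l}=Y_{l-1,l}$, $f_{\alpha'_l}=Z_{l,l-1}$, $h_{\alpha'_l}=X_{l-1,l-1}+X_{l,l}$. The subalgebra $\mathfrak{n}_l=\mathrm{span}_{\mathbb{C}}\{Y_{i,j}\mid 1\le i<j\le l\}$ is abelian and $\mathcal{U}(\mathfrak{n}_l)=\mathbb{C}[\mathfrak{n}_l]$ is the polynomial algebra in the variables $Y_{i,j}$, $i<j$. Since $Y_{j,i}=-Y_{i,j}$ and $Y_{i,i}=0$,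 the convention is $\frac{\partial}{\partial Y_{j,i}}=-\frac{\partial}{\partial Y_{i,j}}$ and $\frac{\partial}{\partial Y_{i,i}}=0$. Differential operators on $\mathbb{C}[\mathfrak{n}_l]$ (products mean composition): $$\widetilde{X}'_{i,j}=\sum_{r<j}Y_{r,i}\frac{\partial}{\partial Y_{r,j}}+\sum_{s>j}Y_{i,s}\frac{\partial}{\partial Y_{j,s}}\quad(1\le i,j\le l),\qquad \widetilde{Z}'_{l,l-1}=\sum_{k=1}^{l-1}\widetilde{X}'_{k,l-1}\frac{\partial}{\partial Y_{k,l}}.$$ For $C\in\mathbb{C}$, $\Psi\in\mathbb{C}[\mathfrak{n}_l]$ put $x'_{i,j}=\widetilde{X}'_{i,j}(\Psi)+\delta_{i,j}C$ and $$z'_{l,l-1}=\Big(\tfrac12\Big(\sum_{k=1}^{l}\widetilde{X}'_{k,l}(\Psi)\tfrac{\partial}{\partial Y_{k,l-1}}-\sum_{k=1}^{l}\widetilde{X}'_{k,l-1}(\Psi)\tfrac{\partial}{\partial Y_{k,l}}\Big)-2C\tfrac{\partial}{\partial Y_{l-1,l}}-\widetilde{Z}'_{l,l-1}\Big)(\Psi).$$ $M_{\mathfrak{n}_l}(C,\Psi)$ is the $\mathfrak{so}_{2l}(\mathbb{C})$-module on $\mathbb{C}[\mathfrak{n}_l]$ given, for $f\in\mathbb{C}[\mathfrak{n}_l]$, by $e_{\alpha_i}\cdot f=(x'_{i,i+1}+\widetilde{X}'_{i,i+1})f$, $f_{\alpha_i}\cdot f=(x'_{i+1,i}+\widetilde{X}'_{i+1,i})f$,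 $h_{\alpha_i}\cdot f=(x'_{i,i}-x'_{i+1,i+1}+\widetilde{X}'_{i,i}-\widetilde{X}'_{i+1,i+1})f$ for $1\le i\le l-1$; $e_{\alpha'_l}\cdot f=Y_{l-1,l}f$, $h_{\alpha'_l}\cdot f=(x'_{l-1,l-1}+x'_{l,l}+\widetilde{X}'_{l-1,l-1}+\widetilde{X}'_{l,l})f$; $f_{\alpha'_l}\cdot f=\Big(z'_{l,l-1}+\sum_{k=1}^{l}\widetilde{X}'_{k,l}(\Psi)\frac{\partial}{\partial Y_{k,l-1}}-\sum_{k=1}^{l}\widetilde{X}'_{k,l-1}(\Psi)\frac{\partial}{\partial Y_{k,l}}-2C\frac{\partial}{\partial Y_{l-1,l}}-\widetilde{Z}'_{l,l-1}\Big)f$. In this module the elements of $\mathfrak{n}_l$ act by multiplication. *)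

(* Defs.v *)
From HB Require Import structures.
From mathcomp Require Import all_boot all_order all_algebra.
From mathcomp Require Import mpoly ring.
From mathcomp Require Import reals.
From mathcomp Require Import complex.

Set Implicit Arguments.
Unset Strict Implicit.
Unset Printing Implicit Defensive.

Import GRing.Theory Num.Theory.
Local Open Scope ring_scope.

Section LieModules.
Variable F : fieldType.

Definition lie_bracket n (A B : 'M[F]_n) : 'M[F]_n := A *m B - B *m A.

(* Only the values [lie_act rho A] with [A \in g] are meaningful. *)
Record lie_module n (g : {vspace 'M[F]_n}) (V : lmodType F) := LieModule {
  lie_act :> 'M[F]_n -> V -> V;
  lie_actDl : forall a A B v, A \in g -> B \in g ->
    lie_act (a *: A + B) v = a *: lie_act A v + lie_act B v;
  lie_actDr : forall A, A \in g -> forall a v w,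
    lie_act A (a *: v + w) = a *: lie_act A v + lie_act A w;
  lie_act_bracket : forall A B v, A \in g -> B \in g ->
    lie_act (lie_bracket A B) v =
      lie_act A (lie_act B v) - lie_act B (lie_act A v) }.

Definition lie_module_iso n (g : {vspace 'M[F]_n}) (V W : lmodType F)
    (rho : lie_module g V) (sigma : lie_module g W) : Prop :=
  exists phi : {linear V -> W}, bijective phi /\
    forall A v, A \in g -> phi (rho A v) = sigma A (phi v).

End LieModules.

Section EvenOrthogonal.
Variables (F : fieldType) (l : nat).

(* Indices are 0-based: i : 'I_l stands for the index i + 1 of the usual
   1-based notation, [up i] for row/column number (i + 1) + 1 and [dn i] for
   row/column number (i + 1) + l + 1 of a matrix of size 2l + 1. *)
Definition up (i : 'I_l) : 'I_(1 + (l + l)) := rshift 1 (lshift l i).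
Definition dn (i : 'I_l) : 'I_(1 + (l + l)) := rshift 1 (rshift l i).

Definition mxX (i j : 'I_l) : 'M[F]_(1 + (l + l)) :=
  delta_mx (up i) (up j) - delta_mx (dn j) (dn i).
Definition mxY (i j : 'I_l) : 'M[F]_(1 + (l + l)) :=
  delta_mx (up i) (dn j) - delta_mx (up j) (dn i).
Definition mxZ (i j : 'I_l) : 'M[F]_(1 + (l + l)) :=
  delta_mx (dn i) (up j) - delta_mx (dn j) (up i).

Definition so2l_gens : seq 'M[F]_(1 + (l + l)) :=
  [seq mxX p.1 p.2 | p <- enum {: 'I_l * 'I_l}] ++
  [seq mxY p.1 p.2 | p <- enum {: 'I_l * 'I_l}] ++
  [seq mxZ p.1 p.2 | p <- enum {: 'I_l * 'I_l}].

Definition so2l : {vspace 'M[F]_(1 + (l + l))} := <<so2l_gens>>%VS.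

End EvenOrthogonal.

Section MatrixBrackets.
Variables (F : fieldType) (l : nat).
Implicit Types (a b i j k m : 'I_l).
Local Notation X := (@mxX F l).
Local Notation Y := (@mxY F l).
Local Notation Z := (@mxZ F l).
Local Notation dl a b := ((a == b)%:R : F).

Lemma up_eq i j : (up i == up j) = (i == j).
Proof. by rewrite (inj_eq (@rshift_inj _ _)) (inj_eq (@lshift_inj _ _)). Qed.
Lemma dn_eq i j : (dn i == dn j) = (i == j).
Proof. by rewrite !(inj_eq (@rshift_inj _ _)). Qed.
Lemma updn_eq i j : (up i == dn j) = false.
Proof. by rewrite (inj_eq (@rshift_inj _ _)) eq_lrshift. Qed.
Lemma dnup_eq i j : (dn i == up j) = false.
Proof. by rewrite eq_sym updn_eq. Qed.
Definition updnE := (up_eq, dn_eq, updn_eq, dnup_eq).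

Lemma mul_delta n (u v v' w : 'I_n) :
  delta_mx u v *m delta_mx v' w = (v == v')%:R *: delta_mx u w :> 'M[F]_n.
Proof. by rewrite mul_delta_mx_cond scaler_nat. Qed.

Let brkE (A B A' B' : 'M[F]_(1 + (l + l))) :
  lie_bracket (A - B) (A' - B') =
    A *m A' - A *m B' - B *m A' + B *m B'
    - A' *m A + A' *m B + B' *m A - B' *m B.
Proof.
rewrite /lie_bracket !mulmxBl !mulmxBr; apply/matrixP=> u v.
by rewrite !mxE; do ?move: (\sum_ _ _) => ?; ring.
Qed.

Ltac brk := apply/matrixP=> u v;
  rewrite /mxX /mxY /mxZ brkE !mul_delta !updnE ?(scale0r, subr0, addr0, sub0r, add0r) !mxE.

Lemma brkXX i j k m :
  lie_bracket (X i j) (X k m) = dl j k *: X i m - dl i m *: X k j.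
Proof. by brk; rewrite (eq_sym m i) (eq_sym k j); ring. Qed.

Lemma brkXY i j a b :
  lie_bracket (X i j) (Y a b) = dl j a *: Y i b - dl j b *: Y i a.
Proof. by brk; rewrite ?(eq_sym a j) ?(eq_sym b j); ring. Qed.

Lemma brkXZ i j a b :
  lie_bracket (X i j) (Z a b) = - (dl i a *: Z j b) - dl i b *: Z a j.
Proof. by brk; rewrite ?(eq_sym a i) ?(eq_sym b i); ring. Qed.

Lemma brkYY i j a b : lie_bracket (Y i j) (Y a b) = 0.
Proof. by rewrite /mxY /mxZ brkE !mul_delta !updnE !scale0r !(subr0, addr0). Qed.

Lemma brkZZ i j a b : lie_bracket (Z i j) (Z a b) = 0.
Proof. by rewrite /mxY /mxZ brkE !mul_delta !updnE !scale0r !(subr0, addr0). Qed.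

Lemma brkZY i j a b : lie_bracket (Z i j) (Y a b) =
  - (dl b i *: X a j - dl b j *: X a i - dl a i *: X b j + dl a j *: X b i).
Proof.
by brk; rewrite ?(eq_sym i a) ?(eq_sym i b) ?(eq_sym j a) ?(eq_sym j b); ring.
Qed.

Lemma mem_mxX i j : X i j \in so2l F l.
Proof.
apply: memv_span; rewrite mem_cat; apply/orP; left.
by apply/mapP; exists (i, j); rewrite ?mem_enum.
Qed.

Lemma mem_mxY i j : Y i j \in so2l F l.
Proof.
apply: memv_span; rewrite !mem_cat; apply/or3P; apply: Or32.
by apply/mapP; exists (i, j); rewrite ?mem_enum.
Qed.

Lemma mem_mxZ i j : Z i j \in so2l F l.
Proof.
apply: memv_span; rewrite !mem_cat; apply/or3P; apply: Or33.
by apply/mapP; exists (i, j); rewrite ?mem_enum.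
Qed.

Lemma so2l_ind (Pr : 'M[F]_(1 + (l + l)) -> Prop) :
  Pr 0 -> (forall c A B, Pr A -> Pr B -> Pr (c *: A + B)) ->
  (forall i j, Pr (X i j)) -> (forall i j, Pr (Y i j)) ->
  (forall i j, Pr (Z i j)) -> forall A, A \in so2l F l -> Pr A.
Proof.
move=> P0 Plin PX PY PZ A.
have PD B B' : Pr B -> Pr B' -> Pr (B + B').
  by move=> hB hB'; rewrite -[B]scale1r; apply: Plin.
have PS c B : Pr B -> Pr (c *: B).
  by move=> hB; rewrite -[_ *: _]addr0; apply: Plin.
move=> /(coord_span (X := in_tuple (so2l_gens F l)))->.
apply: big_ind => // k _; apply: PS.
have : (in_tuple (so2l_gens F l))`_k \in so2l_gens F l by apply: mem_nth.
by rewrite !mem_cat => /or3P[] /mapP[p _ ->].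
Qed.

Lemma so2l_bracket A B :
  A \in so2l F l -> B \in so2l F l -> lie_bracket A B \in so2l F l.
Proof.
have brkC (A' B' : 'M[F]_(1 + (l + l))) : lie_bracket A' B' = - lie_bracket B' A'.
  by rewrite /lie_bracket opprB.
have brkl c (A1 A2 B' : 'M[F]_(1 + (l + l))) :
    lie_bracket (c *: A1 + A2) B' = c *: lie_bracket A1 B' + lie_bracket A2 B'.
  rewrite /lie_bracket mulmxDl mulmxDr -scalemxAl -scalemxAr scalerBr.
  by rewrite opprD addrACA.
have brk0 B' : lie_bracket 0 B' = 0 :> 'M[F]_(1 + (l + l)).
  by rewrite /lie_bracket mul0mx mulmx0 subrr.
have memXYZ := (mem_mxX, mem_mxY, mem_mxZ, rpredZ, rpredB, rpredD, rpredN).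
move=> hA; move: B; apply: so2l_ind => [|c B B' hB hB'|i j|i j|i j].
- by rewrite brkC brk0 oppr0 mem0v.
- by rewrite brkC brkl opprD -scalerN -!brkC rpredD // rpredZ.
all: move: A hA; apply: so2l_ind => [|c A A' hA hA'|k m|k m|k m].
all: rewrite ?brk0 ?mem0v //.
all: try by rewrite brkl rpredD // rpredZ.
all: rewrite ?(brkXX, brkXY, brkXZ, brkYY, brkZZ, brkZY, mem0v) //.
all: rewrite 1?brkC ?(brkXX, brkXY, brkXZ, brkYY, brkZZ, brkZY, mem0v) //.
all: by rewrite ?rpredN; do ?apply: rpredB; do ?apply: rpredD; rewrite ?rpredN;
  do ?apply: rpredB; rewrite ?rpredZ ?memXYZ.
Qed.

End MatrixBrackets.

(* C[n_l] is the polynomial ring with one variable for each pair i < j. *)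
Definition upair (l : nat) := {p : 'I_l * 'I_l | (p.1 < p.2)%N}.
Notation polyY F l := {mpoly F[#|{: upair l}|]}.

Section PolynomialModules.
Variables (F : fieldType) (l : nat).
Local Notation upair := (upair l).
Local Notation polyY := (polyY F l).

Definition vY (i j : 'I_l) : polyY :=
  if insub (i, j) is Some p then 'X_(enum_rank (p : upair)) else 0.
Definition pY (i j : 'I_l) : polyY := vY i j - vY j i.

Definition dvY (i j : 'I_l) (f : polyY) : polyY :=
  if insub (i, j) is Some p then f^`M(enum_rank (p : upair)) else 0.
Definition dY (i j : 'I_l) (f : polyY) : polyY := dvY i j f - dvY j i f.

Definition tX (i j : 'I_l) (f : polyY) : polyY :=
  \sum_(r < l | (r < j)%N) pY r i * dY r j f +
  \sum_(s < l | (j < s)%N) pY i s * dY j s f.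

(* In [tZ], [opPsi], [zc] the arguments p, q stand for l - 1, l. *)
Definition tZ (p q : 'I_l) (f : polyY) : polyY :=
  \sum_(k < l | (k < q)%N) tX k p (dY k q f).

Definition opPsi (Psi : polyY) (p q : 'I_l) (f : polyY) : polyY :=
  \sum_(k < l) tX k q Psi * dY k p f - \sum_(k < l) tX k p Psi * dY k q f.

Definition xc (C : F) (Psi : polyY) (i j : 'I_l) : polyY :=
  tX i j Psi + ((i == j)%:R * C)%:MP.

Definition zc (C : F) (Psi : polyY) (p q : 'I_l) : polyY :=
  2^-1 *: opPsi Psi p q Psi - (2 * C) *: dY p q Psi - tZ p q Psi.

(* The action of the Chevalley generators, in the cases j = i + 1 <= l and
   (p, q) = (l - 1, l); for l >= 2 these generate so_{2l}, so at most one module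
   structure on C[n_l] satisfies the specification. *)
Record M_spec (C : F) (Psi : polyY) (rho : lie_module (so2l F l) polyY) : Prop :=
{ M_e : forall i j : 'I_l, j = i.+1 :> nat -> forall f,
    rho (mxX F i j) f = xc C Psi i j * f + tX i j f;
  M_f : forall i j : 'I_l, j = i.+1 :> nat -> forall f,
    rho (mxX F j i) f = xc C Psi j i * f + tX j i f;
  M_h : forall i j : 'I_l, j = i.+1 :> nat -> forall f,
    rho (mxX F i i - mxX F j j) f =
      (xc C Psi i i - xc C Psi j j) * f + tX i i f - tX j j f;
  M_e' : forall p q : 'I_l, p.+2 = l -> q.+1 = l -> forall f,
    rho (mxY F p q) f = pY p q * f;
  M_h' : forall p q : 'I_l, p.+2 = l -> q.+1 = l -> forall f,
    rho (mxX F p p + mxX F q q) f =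
      (xc C Psi p p + xc C Psi q q) * f + tX p p f + tX q q f;
  M_f' : forall p q : 'I_l, p.+2 = l -> q.+1 = l -> forall f,
    rho (mxZ F q p) f =
      zc C Psi p q * f + opPsi Psi p q f - (2 * C) *: dY p q f - tZ p q f }.

End PolynomialModules.

(* Existence of the modules M_{n_l}(C, Psi): with D i j = d/dY_{ij} + dPsi/dY_{ij},
   X_{ij} acts by Xo i j = sum_r Y_{ri} D_{rj} + delta_{ij} C and Z_{ij} by
   Zo i j = - sum_{r,k} Y_{rk} D_{rj} D_{ki} - 2 C D_{ji}. *)
Module Construction.
Section Construction.
Variables (F : fieldType) (l : nat).
Local Notation P := (polyY F l).
Local Notation Y := (pY F).
Local Notation dl a b := ((a == b)%:R : P).
Implicit Types (a b c d i j k m p q r : 'I_l) (f g : P).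

Lemma pY_anti i j : Y i j = - Y j i.
Proof. by rewrite /pY opprB. Qed.

Lemma dY_anti i j f : dY i j f = - dY j i f.
Proof. by rewrite /dY opprB. Qed.

Lemma dvY_lin i j : linear (@dvY F l i j).
Proof.
by move=> a f g; rewrite /dvY; case: insub => [p|];
  rewrite ?scaler0 ?addr0 // linearP.
Qed.

Lemma dvYM i j f g : dvY i j (f * g) = dvY i j f * g + f * dvY i j g.
Proof.
by rewrite /dvY; case: insub => [p|]; rewrite ?mul0r ?mulr0 ?addr0 // mderivM.
Qed.

Lemma dvY_comm i j c d f : dvY i j (dvY c d f) = dvY c d (dvY i j f).
Proof.
rewrite /dvY; case: (insub (i, j)) => [p|]; case: (insub (c, d)) => [q|] //.
- exact: mderiv_comm.
- exact: raddf0.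
- by rewrite raddf0.
Qed.

Lemma dvYv a b c d :
  dvY a b (vY F c d) = ((a < b)%N && ((a, b) == (c, d)))%:R.
Proof.
rewrite /dvY /vY; case: insubP => [p /= lt_ab Ep|/= /negbTE->] //=.
case: insubP => [q /= lt_cd Eq|/= nlt_cd]; last first.
  rewrite raddf0 lt_ab /=; case: eqP => // -[Ea Eb].
  by rewrite -Ea -Eb lt_ab in nlt_cd.
rewrite mderivX mnm1E lt_ab /= -Ep -Eq (inj_eq val_inj) (inj_eq enum_rank_inj).
rewrite eq_sym; case: eqP => [->|_]; last by rewrite scale0r.
by rewrite scale1r -mpolyX0; congr 'X_[_]; apply/mnmP=> k; rewrite mnmBE mnm0E subnn.
Qed.


Lemma dYv a b c d : dY a b (Y c d) = dl a c * dl b d - dl a d * dl b c.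
Proof.
have dvB u v f g : dvY u v (f - g) = dvY u v f - dvY u v g.
  by rewrite -[f - g]addrC -scaleN1r dvY_lin scaleN1r addrC.
rewrite /dY /pY !dvB !dvYv !xpair_eqE; case: (ltngtP a b) => [ab|ba|/val_inj->].
- by case: (a == c); case: (b == d); case: (a == d); case: (b == c);
    rewrite /= ?mulr1n ?mulr0n; ring.
- by case: (a == c); case: (b == d); case: (a == d); case: (b == c);
    rewrite /= ?mulr1n ?mulr0n; ring.
- rewrite /= !mulr0n; ring.
Qed.

Lemma dY_lin i j : linear (@dY F l i j).
Proof. by move=> a f g; rewrite /dY !dvY_lin scalerBr; ring. Qed.

Lemma dYM i j f g : dY i j (f * g) = dY i j f * g + f * dY i j g.
Proof. by rewrite /dY !dvYM; ring. Qed.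

Lemma dYD i j f g : dY i j (f + g) = dY i j f + dY i j g.
Proof. by rewrite -[f]scale1r dY_lin !scale1r. Qed.

Lemma dYB i j f g : dY i j (f - g) = dY i j f - dY i j g.
Proof. by rewrite addrC -scaleN1r dY_lin scaleN1r addrC. Qed.

Lemma dY_comm i j c d f : dY i j (dY c d f) = dY c d (dY i j f).
Proof.
have dvB u v g h : dvY u v (g - h) = dvY u v g - dvY u v h.
  by rewrite addrC -scaleN1r dvY_lin scaleN1r addrC.
rewrite /dY !dvB (dvY_comm i j) (dvY_comm i j d c) (dvY_comm j i) (dvY_comm j i d c).
by ring.
Qed.

Lemma tXE i j f : tX i j f = \sum_r Y r i * dY r j f.
Proof.
rewrite /tX [X in _ + X](eq_bigr (fun s => Y s i * dY s j f)) => [|s _];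
  last first.
  by rewrite (pY_anti i) (dY_anti j) mulrNN.
rewrite [RHS](bigID (fun r : 'I_l => (r < j)%N)) /=; congr (_ + _).
rewrite [RHS](bigID (fun r : 'I_l => (j < r)%N)) /= [X in _ = _ + X]big1; last first.
  move=> r; rewrite -!leqNgt => /andP[jr rj].
  have -> : r = j by apply/val_inj/eqP; rewrite eqn_leq jr rj.
  by rewrite /dY subrr mulr0.
by rewrite addr0; apply: eq_bigl => r; rewrite -leqNgt; case: ltngtP.
Qed.

Variables (C : F) (Psi : P).

Definition D i j f : P := dY i j f + dY i j Psi * f.

Fact D_lin i j : linear (D i j).
Proof. by move=> a f g; rewrite /D dY_lin -!mul_mpolyC; ring. Qed.
HB.instance Definition _ i j :=
  GRing.isLinear.Build F P P _ (D i j) (D_lin i j).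

Lemma D_anti i j f : D i j f = - D j i f.
Proof. by rewrite /D (dY_anti i) (dY_anti i j Psi); ring. Qed.

Lemma DD a b c d f : D a b (D c d f) = D c d (D a b f).
Proof.
by rewrite /D (dYD a b) (dYD c d) !dYM (dY_comm c d a b f) (dY_comm c d a b Psi); ring.
Qed.

Lemma DY a b c d f :
  D a b (Y c d * f) = Y c d * D a b f + (dl a c * dl b d - dl a d * dl b c) * f.
Proof. by rewrite /D dYM dYv; ring. Qed.

Lemma sumdl a (G : 'I_l -> P) : \sum_r dl r a * G r = G a.
Proof.
rewrite (bigD1 a) //= eqxx mul1r big1 ?addr0 // => r /negbTE->.
by rewrite mul0r.
Qed.

Lemma sumld a (G : 'I_l -> P) : \sum_r dl a r * G r = G a.
Proof. by rewrite -[RHS]sumdl; apply: eq_bigr => r _; rewrite eq_sym. Qed.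

Definition X0 i j f : P := \sum_r Y r i * D r j f.

Fact X0_lin i j : linear (X0 i j).
Proof.
move=> a f g; rewrite /X0 scaler_sumr -big_split; apply: eq_bigr => r _ /=.
by rewrite linearP mulrDr scalerAr.
Qed.
HB.instance Definition _ i j :=
  GRing.isLinear.Build F P P _ (X0 i j) (X0_lin i j).

Lemma X0Y i j a b f :
  X0 i j (Y a b * f) = Y a b * X0 i j f + (dl j b * Y a i - dl j a * Y b i) * f.
Proof.
have -> : X0 i j (Y a b * f) = \sum_r (Y a b * (Y r i * D r j f)
   + dl r a * (Y r i * (dl j b * f)) - dl r b * (Y r i * (dl j a * f))).
  by apply: eq_bigr => r _; rewrite DY; ring.
by rewrite sumrB big_split /= !sumdl -mulr_sumr; rewrite -/(X0 i j f); ring.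
Qed.

Lemma X0D i j a b f :
  X0 i j (D a b f) = D a b (X0 i j f) + dl a i * D b j f - dl b i * D a j f.
Proof.
have -> : D a b (X0 i j f) = \sum_r (Y r i * D r j (D a b f)
   + dl a r * (dl b i * D r j f) - dl b r * (dl a i * D r j f)).
  by rewrite /X0 linear_sum; apply: eq_bigr => r _ /=; rewrite DY (DD r j); ring.
by rewrite sumrB big_split /= !sumld -/(X0 i j _); ring.
Qed.

Lemma X0X0 i j k m f : X0 i j (X0 k m f) =
  X0 k m (X0 i j f) + dl j k * X0 i m f - dl i m * X0 k j f.
Proof.
have -> : X0 i j (X0 k m f) = \sum_r (Y r k * D r m (X0 i j f)
   + dl j k * (Y r i * D r m f) - dl i m * (Y r k * D r j f)
   + dl r i * (Y r k * D m j f) - dl j r * (Y k i * D r m f)).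
  rewrite {2}/X0 linear_sum; apply: eq_bigr => r _ /=.
  by rewrite X0Y X0D (eq_sym i m); ring.
rewrite sumrB big_split /= sumrB big_split /= -!mulr_sumr sumdl sumld.
by rewrite -!/(X0 _ _ _) (D_anti m j) (pY_anti k i); ring.
Qed.

Definition Z0 i j f : P := \sum_k X0 k j (D k i f).
Definition Xo i j f : P := X0 i j f + dl i j * C%:MP * f.
Definition Zo i j f : P := - Z0 i j f - (2 * C)%:MP * D j i f.

Lemma Z0_anti i j f : Z0 i j f = - Z0 j i f.
Proof.
rewrite /Z0 /X0 exchange_big -sumrN; apply: eq_bigr => r _ /=.
rewrite -sumrN; apply: eq_bigr => k _.
by rewrite (DD r j) (pY_anti r) mulNr.
Qed.

Lemma Zo_anti i j f : Zo i j f = - Zo j i f.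
Proof. by rewrite /Zo Z0_anti (D_anti j i); ring. Qed.

Fact Z0_lin i j : linear (Z0 i j).
Proof.
move=> a f g; rewrite /Z0 scaler_sumr -big_split; apply: eq_bigr => r _ /=.
by rewrite !linearP.
Qed.
HB.instance Definition _ i j :=
  GRing.isLinear.Build F P P _ (Z0 i j) (Z0_lin i j).

Fact Xo_lin i j : linear (Xo i j).
Proof.
by move=> a f g; rewrite /Xo X0_lin -!mul_mpolyC; ring.
Qed.
HB.instance Definition _ i j :=
  GRing.isLinear.Build F P P _ (Xo i j) (Xo_lin i j).

Fact Zo_lin i j : linear (Zo i j).
Proof.
by move=> a f g; rewrite /Zo Z0_lin D_lin -!mul_mpolyC; set c := (2 * C)%:MP; ring.
Qed.
HB.instance Definition _ i j :=
  GRing.isLinear.Build F P P _ (Zo i j) (Zo_lin i j).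

Lemma X0C i j (c : F) f : X0 i j (c%:MP * f) = c%:MP * X0 i j f.
Proof. by rewrite mul_mpolyC linearZ mul_mpolyC. Qed.

Lemma dlC a b : dl a b = ((a == b)%:R)%:MP.
Proof. by case: (a == b); rewrite ?mpolyC1 ?mpolyC0. Qed.

Lemma X0dl i j a b f : X0 i j (dl a b * f) = dl a b * X0 i j f.
Proof. by rewrite dlC X0C. Qed.

Lemma X0add i j f g : X0 i j (f + g) = X0 i j f + X0 i j g.
Proof. exact: linearD. Qed.

Lemma XoX0 i j k m f : Xo i j (X0 k m f) =
  X0 k m (Xo i j f) + dl j k * X0 i m f - dl i m * X0 k j f.
Proof. by rewrite /Xo X0add -!mulrA X0dl X0C X0X0; ring. Qed.

Lemma XoE i j f : Xo i j f = X0 i j f + dl i j * C%:MP * f.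
Proof. by []. Qed.

Lemma XoXo i j k m f : Xo i j (Xo k m f) =
  Xo k m (Xo i j f) + dl j k * Xo i m f - dl i m * Xo k j f.
Proof.
rewrite (XoE k m f) linearD /= XoX0 -mulrA.
have -> : Xo i j (dl k m * (C%:MP * f)) = dl k m * (C%:MP * Xo i j f).
  by rewrite /Xo X0dl X0C; ring.
have E : dl j k * dl i m = dl i m * dl k j by rewrite (eq_sym k j) mulrC.
transitivity (Xo k m (Xo i j f) + dl j k * Xo i m f - dl i m * Xo k j f
   + (dl i m * dl k j - dl j k * dl i m) * (C%:MP * f)); last first.
  by rewrite E subrr mul0r addr0.
by rewrite (XoE k m (Xo i j f)) (XoE i m) (XoE k j); ring.
Qed.

Lemma XoY i j a b f :
  Xo i j (Y a b * f) = Y a b * Xo i j f + (dl j a * Y i b - dl j b * Y i a) * f.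
Proof. by rewrite /Xo X0Y (pY_anti a i) (pY_anti b i); ring. Qed.

Lemma Z0D i j a b f : Z0 i j (D a b f) =
  D a b (Z0 i j f) + D b j (D a i f) - D a j (D b i f).
Proof.
rewrite {2}/Z0 linear_sum /=.
have -> : Z0 i j (D a b f) = \sum_k (D a b (X0 k j (D k i f))
    + dl a k * (D b j (D k i f)) - dl b k * D a j (D k i f)).
  by apply: eq_bigr => k _; rewrite DD X0D.
by rewrite sumrB big_split /= !sumld.
Qed.

Lemma X0Z0 p q i j f : X0 p q (Z0 i j f) =
  Z0 i j (X0 p q f) - dl p i * Z0 q j f - dl p j * Z0 i q f.
Proof.
have -> : X0 p q (Z0 i j f) = \sum_k (X0 k j (D k i (X0 p q f))
   - dl p i * X0 k j (D k q f) - dl p j * X0 k q (D k i f)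
   + dl k p * X0 k j (D i q f) + dl q k * X0 p j (D k i f)).
  rewrite {1}/Z0 linear_sum; apply: eq_bigr => k _ /=.
  have -> : X0 k j (D k i (X0 p q f)) = X0 k j (X0 p q (D k i f))
     - dl k p * X0 k j (D i q f) + dl p i * X0 k j (D k q f).
    rewrite -!X0dl -linearB -linearD /= (X0D p q k i) (eq_sym i p).
    by congr X0; ring.
  by rewrite (X0X0 p q k j); ring.
rewrite !big_split /= !sumrN -!mulr_sumr !sumdl sumld.
have -> : X0 p j (D q i f) = - X0 p j (D i q f) by rewrite (D_anti q i) linearN.
by rewrite -!/(Z0 _ _ _); ring.
Qed.

Lemma X0Zo p q i j f : X0 p q (Zo i j f) =
  Zo i j (X0 p q f) - dl p i * Zo q j f - dl p j * Zo i q f.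
Proof.
rewrite {1}/Zo linearB linearN /= X0Z0 X0C X0D /Zo.
by rewrite (eq_sym j p) (eq_sym i p) (D_anti i q f); ring.
Qed.

Lemma ZoC i j (c : F) f : Zo i j (c%:MP * f) = c%:MP * Zo i j f.
Proof. by rewrite mul_mpolyC linearZ mul_mpolyC. Qed.

Lemma XoZo p q i j f : Xo p q (Zo i j f) =
  Zo i j (Xo p q f) - dl p i * Zo q j f - dl p j * Zo i q f.
Proof.
rewrite {1}/Xo X0Zo.
have -> : Zo i j (Xo p q f) = Zo i j (X0 p q f) + dl p q * C%:MP * Zo i j f.
  by rewrite /Xo linearD /= dlC -mpolyCM ZoC.
by ring.
Qed.

Lemma ZoD i j a b f : Zo i j (D a b f) =
  D a b (Zo i j f) + D a j (D b i f) - D b j (D a i f).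
Proof.
have DC (c : F) g : D a b (c%:MP * g) = c%:MP * D a b g.
  by rewrite mul_mpolyC linearZ mul_mpolyC.
have -> : D a b (Zo i j f) = - D a b (Z0 i j f) - (2 * C)%:MP * D a b (D j i f).
  by rewrite -DC -[- D a b _](linearN (D a b)) -[RHS](linearB (D a b)).
by rewrite /Zo Z0D (DD j i) (DD a j) (DD b j); ring.
Qed.

Lemma ZoY i j a b f : Zo i j (Y a b * f) = Y a b * Zo i j f
  - (dl b i * Xo a j f - dl b j * Xo a i f - dl a i * Xo b j f + dl a j * Xo b i f).
Proof.
have ZY : Z0 i j (Y a b * f) = Y a b * Z0 i j f - dl b j * X0 a i f
    + dl a j * X0 b i f + dl b i * X0 a j f - dl a i * X0 b j f.
  have -> : Z0 i j (Y a b * f) = \sum_k (Y a b * X0 k j (D k i f)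
     - dl b j * (Y k a * D k i f) + dl a j * (Y k b * D k i f)
     + dl k a * (dl b i * X0 k j f) - dl k b * (dl a i * X0 k j f)).
    apply: eq_bigr => k _; rewrite DY [_ * f]mulrBl linearD /= X0Y linearB /=.
    rewrite -!mulrA !X0dl (pY_anti a k) (pY_anti b k).
    by rewrite (eq_sym i a) (eq_sym i b) (eq_sym j a) (eq_sym j b); ring.
  rewrite !big_split /= !sumrN -!mulr_sumr !sumdl.
  by rewrite -!/(X0 _ _ _) -/(Z0 _ _ _).
rewrite /Zo ZY DY /Xo (eq_sym i a) (eq_sym i b) (eq_sym j a) (eq_sym j b).
by rewrite mpolyCM mpolyC_nat; ring.
Qed.

Lemma ZoZo i j a b f : Zo i j (Zo a b f) = Zo a b (Zo i j f).
Proof.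
have ZZ : Zo i j (Z0 a b f) = Z0 a b (Zo i j f) + Z0 j b (D a i f)
    - Z0 i b (D a j f) + Zo b j (D i a f) + Zo i b (D j a f).
  rewrite {1}/Z0 linear_sum /=.
  transitivity (\sum_k (X0 k b (D k a (Zo i j f)) + X0 k b (D k j (D a i f))
    - X0 k b (D k i (D a j f)) + dl k i * Zo b j (D k a f)
    + dl k j * Zo i b (D k a f))); last first.
    by rewrite !big_split /= !sumrN !sumdl.
  apply: eq_bigr => k _; have -> : Zo i j (X0 k b (D k a f)) = X0 k b (Zo i j (D k a f))
    + dl k i * Zo b j (D k a f) + dl k j * Zo i b (D k a f) by rewrite X0Zo; ring.
  rewrite ZoD (DD a j).
  by rewrite [X0 k b (_ - _)]linearB /= X0add; ring.
have Z1 : Zo b j (D i a f) = - Z0 j b (D a i f) - (2 * C)%:MP * D b j (D a i f).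
  by rewrite (D_anti i a) linearN /= Zo_anti opprK.
have Z2 : Zo i b (D j a f) = Z0 i b (D a j f) + (2 * C)%:MP * D b i (D a j f).
  by rewrite (D_anti j a) linearN /= /Zo; ring.
have -> : Zo i j (Zo a b f) = - Zo i j (Z0 a b f) - (2 * C)%:MP * Zo i j (D b a f).
  by rewrite -ZoC -[- Zo i j _](linearN (Zo i j)) -[RHS](linearB (Zo i j)).
by rewrite ZZ Z1 Z2 ZoD (DD a j b i) [RHS]/Zo; ring.
Qed.

Lemma Xo_xc i j f : Xo i j f = xc C Psi i j * f + tX i j f.
Proof.
have -> : Xo i j f = tX i j Psi * f + tX i j f + dl i j * C%:MP * f.
  rewrite /Xo !tXE mulr_suml -big_split; congr (_ + _).
  by apply: eq_bigr => r _; rewrite /D /=; ring.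
by rewrite /xc mpolyCM dlC; ring.
Qed.

Lemma tXM i j f g : tX i j (f * g) = tX i j f * g + f * tX i j g.
Proof.
rewrite !tXE mulr_suml mulr_sumr -big_split; apply: eq_bigr => r _ /=.
by rewrite dYM; ring.
Qed.

Lemma X0E i j f : X0 i j f = tX i j f + tX i j Psi * f.
Proof.
rewrite !tXE mulr_suml -big_split; apply: eq_bigr => r _ /=.
by rewrite /D; ring.
Qed.

Lemma tXD i j f g : tX i j (f + g) = tX i j f + tX i j g.
Proof.
rewrite !tXE -big_split; apply: eq_bigr => r _ /=.
by rewrite dYD mulrDr.
Qed.

Lemma dYii i f : dY i i f = 0.
Proof. exact: subrr. Qed.

Lemma opPsi_swap p q f :
  \sum_k dY k q Psi * tX k p f = - \sum_k tX k q Psi * dY k p f.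
Proof.
under eq_bigr do rewrite tXE mulr_sumr.
rewrite exchange_big -sumrN; apply: eq_bigr => r _ /=.
rewrite tXE mulr_suml -sumrN; apply: eq_bigr => k _.
by rewrite (pY_anti r k); ring.
Qed.

Lemma Zo_zc p q f : 2 != 0 :> F -> q.+1 = l -> Zo q p f =
  zc C Psi p q * f + opPsi Psi p q f - (2 * C) *: dY p q f - tZ p q f.
Proof.
move=> two_neq0 ql.
have tZE g : tZ p q g = \sum_k tX k p (dY k q g).
  rewrite /tZ [RHS](bigID (fun k : 'I_l => (k < q)%N)) /= [X in _ = _ + X]big1.
    by rewrite addr0.
  move=> k; rewrite -leqNgt => qk.
  have -> : k = q by apply/val_inj/eqP; rewrite eqn_leq qk -ltnS ql ltn_ord.
  rewrite dYii tXE big1 // => r _.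
  by have := dYB r p 0 0; rewrite !subrr => ->; rewrite mulr0.
pose H g := \sum_k tX k p Psi * dY k q g.
pose G g := \sum_k tX k q Psi * dY k p g.
have GH : G Psi = - H Psi.
  by rewrite -[G Psi]opprK -opPsi_swap; congr (- _); apply: eq_bigr => k _; rewrite mulrC.
have -> : Zo q p f = - (tZ p q f + tZ p q Psi * f - G f + H f + H Psi * f)
    - (2 * C)%:MP * (dY p q f + dY p q Psi * f).
  rewrite /Zo; congr (- _ - _); rewrite !tZE /G -opPsi_swap /H /Z0 !mulr_suml.
  rewrite -!big_split; apply: eq_bigr => k _ /=.
  by rewrite X0E /D tXD tXM; ring.
have -> : zc C Psi p q = - H Psi - (2 * C) *: dY p q Psi - tZ p q Psi.
  rewrite /zc /opPsi -/(H Psi) -/(G Psi) GH -opprD scalerN -mulr2n.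
  by rewrite -scaler_nat scalerA mulVf // scale1r.
by rewrite /opPsi -/(H f) -/(G f) -!mul_mpolyC; set c := (2 * C)%:MP; ring.
Qed.

(* The action of an arbitrary matrix, read off from its blocks. *)
Definition Mact (A : 'M[F]_(1 + (l + l))) f : P :=
  \sum_i \sum_j (A (up i) (up j) *: Xo i j f
    + (2^-1 * A (up i) (dn j)) *: (Y i j * f)
    + (2^-1 * A (dn i) (up j)) *: Zo i j f).

Lemma Mact_linl (c : F) A B f : Mact (c *: A + B) f = c *: Mact A f + Mact B f.
Proof.
rewrite /Mact scaler_sumr -big_split; apply: eq_bigr => i _ /=.
rewrite scaler_sumr -big_split; apply: eq_bigr => j _ /=.
rewrite !mxE -!mul_mpolyC !(mpolyCM, mpolyCD).
move: (A _ _)%:MP (A _ _)%:MP (A _ _)%:MP (B _ _)%:MP (B _ _)%:MP (B _ _)%:MP.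
by move=> *; ring.
Qed.

Lemma Mact_linr (c : F) A f g : Mact A (c *: f + g) = c *: Mact A f + Mact A g.
Proof.
rewrite /Mact scaler_sumr -big_split; apply: eq_bigr => i _ /=.
rewrite scaler_sumr -big_split; apply: eq_bigr => j _ /=.
by rewrite Xo_lin Zo_lin -!mul_mpolyC; ring.
Qed.

Lemma sum2dl a b (G : 'I_l -> 'I_l -> P) :
  \sum_i \sum_j ((i == a) && (j == b))%:R *: G i j = G a b.
Proof.
rewrite (bigD1 a) //= [X in _ + X]big1 ?addr0 => [|i /negbTE->]; last first.
  by rewrite big1 // => j _; rewrite scale0r.
rewrite (bigD1 b) //= !eqxx scale1r big1 ?addr0 // => j /negbTE->.
by rewrite scale0r.
Qed.

Lemma MactX a b f : Mact (mxX F a b) f = Xo a b f.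
Proof.
rewrite -[RHS](sum2dl a b (fun i j => Xo i j f)); apply: eq_bigr => i _.
apply: eq_bigr => j _; rewrite !mxE !updnE /= ?andbF /=.
by rewrite !mulr0n !subr0 !mulr0 !scale0r !addr0.
Qed.

Lemma MactY a b f : 2 != 0 :> F -> Mact (mxY F a b) f = Y a b * f.
Proof.
move=> two_neq0.
have -> : Y a b * f = 2^-1 *: (Y a b * f - Y b a * f).
  by rewrite (pY_anti b a) mulNr opprK -mulr2n -scaler_nat scalerA mulVf // scale1r.
rewrite -(sum2dl a b (fun i j => Y i j * f)) -(sum2dl b a (fun i j => Y i j * f)).
rewrite -sumrB scaler_sumr; apply: eq_bigr => i _.
rewrite -sumrB scaler_sumr; apply: eq_bigr => j _.
rewrite !mxE !updnE /= ?andbF /= !mulr0n !subr0 !mulr0 !scale0r add0r addr0.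
by rewrite -scalerA scalerBl.
Qed.

Lemma MactZ a b f : 2 != 0 :> F -> Mact (mxZ F a b) f = Zo a b f.
Proof.
move=> two_neq0.
have -> : Zo a b f = 2^-1 *: (Zo a b f - Zo b a f).
  by rewrite (Zo_anti b a) opprK -mulr2n -scaler_nat scalerA mulVf // scale1r.
rewrite -(sum2dl a b (fun i j => Zo i j f)) -(sum2dl b a (fun i j => Zo i j f)).
rewrite -sumrB scaler_sumr; apply: eq_bigr => i _.
rewrite -sumrB scaler_sumr; apply: eq_bigr => j _.
rewrite !mxE !updnE /= ?andbF /= !mulr0n !subr0 !mulr0 !scale0r !add0r.
by rewrite -scalerA scalerBl.
Qed.

Lemma Mact0 f : Mact 0 f = 0.
Proof.
by have := Mact_linl (-1) 0 0 f; rewrite scaler0 addr0 scaleN1r addNr.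
Qed.

Definition brk_stable (A B : 'M[F]_(1 + (l + l))) := forall f,
  Mact (lie_bracket A B) f = Mact A (Mact B f) - Mact B (Mact A f).

Lemma brk_stable_lin (c : F) A A' B :
  brk_stable A B -> brk_stable A' B -> brk_stable (c *: A + A') B.
Proof.
move=> hA hA' f; rewrite !Mact_linl Mact_linr.
have -> : lie_bracket (c *: A + A') B = c *: lie_bracket A B + lie_bracket A' B.
  rewrite /lie_bracket mulmxDl mulmxDr -scalemxAl -scalemxAr scalerBr.
  by rewrite opprD addrACA.
by rewrite Mact_linl hA hA' scalerBr opprD addrACA.
Qed.

Lemma brk_stable_sym A B : brk_stable A B -> brk_stable B A.
Proof.
move=> h f; rewrite -[RHS]opprB -h.
have -> : lie_bracket B A = (-1) *: lie_bracket A B + 0.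
  by rewrite addr0 scaleN1r /lie_bracket opprB.
by rewrite Mact_linl scaleN1r Mact0 addr0.
Qed.

Lemma MactDl A B f : Mact (A + B) f = Mact A f + Mact B f.
Proof. by rewrite -[A in LHS]scale1r Mact_linl scale1r. Qed.

Lemma MactNl A f : Mact (- A) f = - Mact A f.
Proof. by rewrite -scaleN1r -[_ *: A]addr0 Mact_linl Mact0 addr0 scaleN1r. Qed.

Lemma MactZl (c : F) A f : Mact (c *: A) f = c%:MP * Mact A f.
Proof. by rewrite -[c *: A]addr0 Mact_linl Mact0 addr0 mul_mpolyC. Qed.

Hypothesis two_neq0 : 2 != 0 :> F.

Let MactY' a b f : Mact (mxY F a b) f = Y a b * f := MactY a b f two_neq0.
Let MactZ' a b f : Mact (mxZ F a b) f = Zo a b f := MactZ a b f two_neq0.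

Lemma MactB (c d : F) A B f :
  Mact (c *: A - d *: B) f = c%:MP * Mact A f - d%:MP * Mact B f.
Proof. by rewrite MactDl MactNl !MactZl. Qed.

Lemma MactNB (c d : F) A B f :
  Mact (- (c *: A) - d *: B) f = - (c%:MP * Mact A f) - d%:MP * Mact B f.
Proof. by rewrite MactDl !MactNl !MactZl. Qed.

Lemma Mact4 (c1 c2 c3 c4 : F) A1 A2 A3 A4 f :
  Mact (- (c1 *: A1 - c2 *: A2 - c3 *: A3 + c4 *: A4)) f =
    - (c1%:MP * Mact A1 f - c2%:MP * Mact A2 f - c3%:MP * Mact A3 f
       + c4%:MP * Mact A4 f).
Proof. by rewrite !(MactNl, MactDl, MactZl). Qed.

Lemma brk_stable_so A B :
  A \in so2l F l -> B \in so2l F l -> brk_stable A B.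
Proof.
have st0 A' : brk_stable 0 A'.
  move=> f; have -> : lie_bracket 0 A' = 0 :> 'M[F]_(1 + (l + l)).
    by rewrite /lie_bracket mul0mx mulmx0 subrr.
  have Mact0r : Mact A' 0 = 0.
    by have := @Mact_linr (-1) A' 0 0; rewrite scaler0 addr0 scaleN1r addNr.
  by rewrite !Mact0 Mact0r subrr.
have XX i j k m : brk_stable (mxX F i j) (mxX F k m).
  move=> f; rewrite brkXX MactB (MactX i m) (MactX k j) (MactX k m) (MactX i j).
  by rewrite (MactX i j) (MactX k m) XoXo -!dlC; ring.
have XY i j k m : brk_stable (mxX F i j) (mxY F k m).
  move=> f; rewrite brkXY MactB !(MactY' i) !(MactY' k m) !(MactX i j) XoY.
  by rewrite -!dlC; ring.
have XZ i j k m : brk_stable (mxX F i j) (mxZ F k m).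
  move=> f; rewrite brkXZ MactNB (MactZ' j m) (MactZ' k j) !(MactZ' k m).
  by rewrite !(MactX i j) XoZo -!dlC; ring.
have ZY i j k m : brk_stable (mxZ F i j) (mxY F k m).
  move=> f; rewrite brkZY Mact4.
  rewrite !(MactX k) !(MactX m) !(MactY' k m) !(MactZ' i j) ZoY.
  by rewrite -!dlC; ring.
have YY i j k m : brk_stable (mxY F i j) (mxY F k m).
  move=> f; rewrite brkYY Mact0 !(MactY' k m) !(MactY' i j) ?(MactY' k m).
  by ring.
have ZZ i j k m : brk_stable (mxZ F i j) (mxZ F k m).
  move=> f; rewrite brkZZ Mact0 !(MactZ' k m) !(MactZ' i j) ?(MactZ' k m) ZoZo.
  by rewrite subrr.
move=> hA; move: B; apply: so2l_ind => [|c B B' hB hB'|k m|k m|k m].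
- exact/brk_stable_sym/st0.
- by apply: brk_stable_sym; apply: brk_stable_lin; apply: brk_stable_sym.
- move: A hA; apply: so2l_ind => [|c A A' hA hA'|i j|i j|i j].
  + exact: st0.
  + exact: brk_stable_lin hA hA'.
  + exact: XX.
  + exact/brk_stable_sym/XY.
  + exact/brk_stable_sym/XZ.
- move: A hA; apply: so2l_ind => [|c A A' hA hA'|i j|i j|i j].
  + exact: st0.
  + exact: brk_stable_lin hA hA'.
  + exact: XY.
  + exact: YY.
  + exact: ZY.
- move: A hA; apply: so2l_ind => [|c A A' hA hA'|i j|i j|i j].
  + exact: st0.
  + exact: brk_stable_lin hA hA'.
  + exact: XZ.
  + exact/brk_stable_sym/ZY.
  + exact: ZZ.
Qed.

Definition Mlie : lie_module (so2l F l) P.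
Proof.
refine (@LieModule F _ (so2l F l) P Mact _ _ _).
- by move=> c A B f _ _; apply: Mact_linl.
- by move=> A _ c f g; apply: Mact_linr.
- by move=> A B f hA hB; apply: brk_stable_so.
Defined.

Lemma Mlie_spec : M_spec C Psi Mlie.
Proof.
split=> i j => [_|_|_|_ _|_ _|_ jl] f.
- by rewrite [LHS](MactX i j) Xo_xc.
- by rewrite [LHS](MactX j i) Xo_xc.
- by rewrite [LHS](MactDl (mxX F i i)) MactNl (MactX i i) (MactX j j) !Xo_xc; ring.
- exact: MactY'.
- by rewrite [LHS](MactDl (mxX F i i)) (MactX i i) (MactX j j) !Xo_xc; ring.
- by rewrite [LHS](MactZ' j i); apply: Zo_zc.
Qed.

End Construction.
End Construction.

Lemma M_exists (F : numFieldType) (l : nat) (C : F) (Psi : polyY F l) :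
  {rho : lie_module (so2l F l) (polyY F l) | M_spec C Psi rho}.
Proof.
have two_neq0 : 2 != 0 :> F by rewrite pnatr_eq0.
by exists (Construction.Mlie C Psi two_neq0); apply: Construction.Mlie_spec.
Qed.

(* Since [M_exists] is opaque, [modM C Psi] is only known through [M_spec]. *)
Definition modM (F : numFieldType) (l : nat) (C : F) (Psi : polyY F l) :
  lie_module (so2l F l) (polyY F l) := sval (M_exists C Psi).

Lemma modMP (F : numFieldType) (l : nat) (C : F) (Psi : polyY F l) :
  M_spec C Psi (modM C Psi).
Proof. exact: svalP. Qed.

(* Main.v *)
Require Import Defs.
From mathcomp Require Import all_boot all_order all_algebra.
From mathcomp Require Import mpoly reals complex.

Local Open Scope ring_scope.
Import GRing.Theory Num.Theory Construction.

(** An isomorphism [phi] commutes with the action of every [Y_ij], that is, with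
multiplication by every variable, so [phi f = f * phi 1]
([linear_comm_vars_mulE]).  As [phi] is onto, [phi 1] is an invertible
polynomial, hence a nonzero scalar, and the two modules have literally the same
action ([modM_iso_act_eq]).

It remains to recover [C] and [Psi] from the action.  Let [X_11 + ... + X_ll]
act on the polynomial [1]: the result is [sum_i tX_ii(Psi) + l C].  The operator
[sum_i tX_ii] is twice the Euler operator ([sum_tX_diag]), so it multiplies the
coefficient of a monomial [m] by [2 deg m] ([mcoeff_euler]).  Comparing
constant terms gives [l C1 = l C2]; comparing the other coefficients gives that
[Psi1] and [Psi2] agree outside the constant term, since the characteristic is
0.

Conversely, [Psi] enters the action only through its derivatives, so
shifting it by a constant changes nothing and the identity is an isomorphism.

The modules are specified on Chevalley generators only, whereas the argument
uses the action of every [X_ij] and [Y_ij].  The link is that [e_i] and [f_i]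
generate [so_2l] for [l >= 2] ([so2l_chevalley_ind]); a module structure
satisfying the specification is therefore unique ([M_spec_unique]) and is given
by the explicit operators of [Construction.Mlie]. *)

(** * Generation by Chevalley generators *)

Section Generation.
Context {F : fieldType} {l : nat}.
Context (l_ge2 : (2 <= l)%N) (two_neq0 : 2 != 0 :> F).

(** Why the [e_i] and [f_i] generate: brackets of neighbouring [X_{i,i+1}]
and [X_{i+1,i}] give all off-diagonal [X_ij] and then the differences
[X_ii - X_jj]; the bracket of [Z_{l,l-1}] with [Y_{l-1,l}] is
[-(X_{l-1,l-1} + X_ll)], which together with these differences and division by 2
gives each [X_ii]; finally the [X_ij] move the indices of [Y_{l-1,l}] and
[Z_{l,l-1}] to arbitrary positions. *)
Lemma so2l_chevalley_ind (Pr : 'M[F]_(1 + (l + l)) -> Prop) :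
  Pr 0 ->
  (forall c A B, A \in so2l F l -> B \in so2l F l ->
    Pr A -> Pr B -> Pr (c *: A + B)) ->
  (forall A B, A \in so2l F l -> B \in so2l F l ->
    Pr A -> Pr B -> Pr (lie_bracket A B)) ->
  (forall i j : 'I_l, j = i.+1 :> nat -> Pr (mxX F i j)) ->
  (forall i j : 'I_l, j = i.+1 :> nat -> Pr (mxX F j i)) ->
  (forall p q : 'I_l, p.+2 = l -> q.+1 = l -> Pr (mxY F p q)) ->
  (forall p q : 'I_l, p.+2 = l -> q.+1 = l -> Pr (mxZ F q p)) ->
  forall A, A \in so2l F l -> Pr A.
Proof.
move=> P0 Plin Pbrk Pe Pf Pe' Pf'.
have [p [q [pl ql]]] : exists p q : 'I_l, p.+2 = l /\ q.+1 = l.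
  case: l l_ge2 => [|[|n]] // _.
  by exists (inord n), (inord n.+1); rewrite !inordK.
(* Membership is carried along, as [Pr] is only closed under brackets in [so2l]. *)
pose Q A := A \in so2l F l /\ Pr A.
have Qlin c A B : Q A -> Q B -> Q (c *: A + B).
  by move=> [hA pA] [hB pB]; split; [rewrite rpredD ?rpredZ | apply: Plin].
have Q0 : Q 0 by split; first exact: mem0v.
have QZ c A : Q A -> Q (c *: A).
  by move=> hA; rewrite -[_ *: _]addr0; apply: Qlin.
have QN A : Q A -> Q (- A) by rewrite -scaleN1r; apply: QZ.
have QN' A : Q (- A) -> Q A by move=> /QN; rewrite opprK.
have QD A B : Q A -> Q B -> Q (A + B) by rewrite -[A in A + B]scale1r; apply: Qlin.
have Qbrk A B : Q A -> Q B -> Q (lie_bracket A B).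
  by move=> [hA pA] [hB pB]; split; [apply: so2l_bracket | apply: Pbrk].
have qDp : (q == p) = false.
  apply/eqP=> qp; have : p.+2 = q.+1 by rewrite pl ql.
  by rewrite qp => /eqP; rewrite eqn_leq ltnn.
(* Induction on the distance between the two indices, through [k = j - 1]. *)
have XupN n (i j : 'I_l) : j = (i + n.+1)%N :> nat ->
    Q (mxX F i j) /\ Q (mxX F j i).
  elim: n j => [|n IHn] j; rewrite ?addn1 => ij.
    by split; split; rewrite ?mem_mxX //; [apply: Pe | apply: Pf].
  have ltkl : (i + n.+1 < l)%N.
    by apply: leq_ltn_trans (ltn_ord j); rewrite ij leq_add2l.
  pose k := Ordinal ltkl; have [Qik Qki] := IHn k erefl.
  have kj : j = k.+1 :> nat by rewrite ij addnS.
  have Qkj : Q (mxX F k j) by split; [exact: mem_mxX | apply: Pe].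
  have Qjk : Q (mxX F j k) by split; [exact: mem_mxX | apply: Pf].
  have ijF : (i == j) = false by rewrite -val_eqE /= ij -[X in X == _]addn0 eqn_add2l.
  have := Qbrk _ _ Qik Qkj; have := Qbrk _ _ Qjk Qki.
  by rewrite !brkXX !eqxx [j == i]eq_sym ijF !scale1r !scale0r !subr0.
have Xoff (i j : 'I_l) : i != j -> Q (mxX F i j).
  rewrite neq_ltn => /orP[ij|ji].
    by have [] := XupN (j - i.+1)%N i j; rewrite ?addnS -?addSn ?subnKC.
  by have [] := XupN (i - j.+1)%N j i; rewrite ?addnS -?addSn ?subnKC.
have QYpq : Q (mxY F p q) by split; [exact: mem_mxY | apply: Pe'].
have QZqp : Q (mxZ F q p) by split; [exact: mem_mxZ | apply: Pf'].
have Xdiff (i j : 'I_l) : i != j -> Q (mxX F i i - mxX F j j).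
  move=> ij; have ji : j != i by rewrite eq_sym.
  have := Qbrk _ _ (Xoff _ _ ij) (Xoff _ _ ji).
  by rewrite brkXX !eqxx !scale1r.
have Xpp : Q (mxX F p p).
  have := Qbrk _ _ QZqp QYpq; rewrite brkZY !eqxx qDp [p == q]eq_sym qDp.
  rewrite !scale0r !scale1r !subr0 => /QN'/(QD _ _ (Xdiff p q _)).
  rewrite [p == q]eq_sym qDp => /(_ isT).
  rewrite addrACA addNr addr0 -mulr2n -scaler_nat => /(QZ 2^-1).
  by rewrite scalerA mulVf // scale1r.
have QX (i j : 'I_l) : Q (mxX F i j).
  have [->{i}|] := eqVneq i j; last exact: Xoff.
  have [->//|jp] := eqVneq j p.
  by rewrite -[mxX F j j](subrK (mxX F p p)); apply: QD => //; apply: Xdiff.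
have antiY (i j : 'I_l) : mxY F j i = - mxY F i j by rewrite /mxY opprB.
have antiZ (i j : 'I_l) : mxZ F j i = - mxZ F i j by rewrite /mxZ opprB.
have QYq i : Q (mxY F i q).
  have := Qbrk _ _ (QX i p) QYpq.
  by rewrite brkXY eqxx [p == q]eq_sym qDp scale1r scale0r subr0.
have QY i j : Q (mxY F i j).
  have [->|iq] := eqVneq i q; first by rewrite antiY; apply: QN.
  have := Qbrk _ _ (QX j q) (QYq i).
  by rewrite brkXY eqxx [q == i]eq_sym (negbTE iq) scale1r scale0r sub0r -antiY.
have QZp i : Q (mxZ F i p).
  have := Qbrk _ _ (QX q i) QZqp.
  by rewrite brkXZ eqxx qDp scale1r scale0r subr0 => /QN'.
have QZZ i j : Q (mxZ F i j).
  have [->|ip] := eqVneq i p; first by rewrite antiZ; apply: QN.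
  have := Qbrk _ _ (QX p j) (QZp i).
  by rewrite brkXZ eqxx [p == i]eq_sym (negbTE ip) scale1r scale0r oppr0 sub0r => /QN'.
move=> A hA; suff [] : Q A by [].
by move: A hA; apply: so2l_ind.
Qed.

(** The matrices on which two such actions agree are closed under linear
combinations and brackets and contain the generators. *)
Lemma M_spec_unique {C Psi} {rho sigma : lie_module (so2l F l) (polyY F l)} :
  M_spec C Psi rho -> M_spec C Psi sigma ->
  forall A, A \in so2l F l -> forall f, rho A f = sigma A f.
Proof.
move=> hrho hsigma; apply: so2l_chevalley_ind.
- have act0 (tau : lie_module (so2l F l) (polyY F l)) f : tau 0 f = 0.
    have := lie_actDl tau (-1) f (mem0v _) (mem0v _).
    by rewrite scaler0 addr0 scaleN1r addNr.
  by move=> f; rewrite !act0.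
- by move=> c A B hA hB eA eB f; rewrite !lie_actDl // eA eB.
- by move=> A B hA hB eA eB f; rewrite !lie_act_bracket // !(eA, eB).
- by move=> i j ij f; rewrite (M_e hrho ij) (M_e hsigma ij).
- by move=> i j ij f; rewrite (M_f hrho ij) (M_f hsigma ij).
- by move=> p q pl ql f; rewrite (M_e' hrho pl ql) (M_e' hsigma pl ql).
- by move=> p q pl ql f; rewrite (M_f' hrho pl ql) (M_f' hsigma pl ql).
Qed.

End Generation.

(** * The action of all [X_ij] and [Y_ij] *)

Section ModuleFormulas.
Context {F : numFieldType} {l : nat} (l_ge2 : (2 <= l)%N).
Implicit Types (C : F) (Psi f : polyY F l).

Let two_neq0 : 2 != 0 :> F. Proof. by rewrite pnatr_eq0. Qed.

Lemma modM_X C Psi i j f :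
  modM C Psi (mxX F i j) f = xc C Psi i j * f + tX i j f.
Proof.
rewrite (M_spec_unique l_ge2 two_neq0 (modMP C Psi) (Mlie_spec C Psi two_neq0)).
  by rewrite [LHS]MactX Xo_xc.
exact: mem_mxX.
Qed.

Lemma modM_Y C Psi i j f : modM C Psi (mxY F i j) f = pY F i j * f.
Proof.
rewrite (M_spec_unique l_ge2 two_neq0 (modMP C Psi) (Mlie_spec C Psi two_neq0)).
  exact: MactY.
exact: mem_mxY.
Qed.

Lemma dvY_const i j (c : F) : dvY i j (c%:MP : polyY F l) = 0.
Proof. by rewrite /dvY; case: insub => // p; rewrite mderivC. Qed.

Lemma dY_const i j (c : F) : dY i j (c%:MP : polyY F l) = 0.
Proof. by rewrite /dY !dvY_const subrr. Qed.

(** All coefficients in the specification involve [Psi] only through its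
derivatives. *)
Lemma M_spec_shift {C Psi1 Psi2} {c : F}
    {rho : lie_module (so2l F l) (polyY F l)} :
  Psi1 - Psi2 = c%:MP -> M_spec C Psi1 rho -> M_spec C Psi2 rho.
Proof.
move=> /eqP; rewrite subr_eq => /eqP def1.
have dE i j : dY i j Psi1 = dY i j Psi2 by rewrite def1 dYD dY_const add0r.
have tE i j : tX i j Psi1 = tX i j Psi2.
  by rewrite !tXE; apply: eq_bigr => r _; rewrite dE.
have xE i j : xc C Psi1 i j = xc C Psi2 i j by rewrite /xc tE.
have oE p q f : opPsi Psi1 p q f = opPsi Psi2 p q f.
  by rewrite /opPsi; congr (_ - _); apply: eq_bigr => k _; rewrite tE.
have zE p q : zc C Psi1 p q = zc C Psi2 p q.
  rewrite /zc oE dE; congr (2^-1 *: _ - _ - _).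
    by rewrite /opPsi; congr (_ - _); apply: eq_bigr => k _; rewrite dE.
  by apply: eq_bigr => k _; rewrite dE.
case=> he hf hh he' hh' hf'; split=> // i j *.
- by rewrite he // xE.
- by rewrite hf // xE.
- by rewrite hh // !xE.
- by rewrite hh' // !xE.
- by rewrite hf' // zE oE.
Qed.

Lemma modM_shift C {Psi1 Psi2} {c : F} :
  Psi1 - Psi2 = c%:MP ->
  forall A, A \in so2l F l -> forall f, modM C Psi1 A f = modM C Psi2 A f.
Proof.
move=> dPsi; have h := M_spec_shift dPsi (modMP C Psi1).
exact (M_spec_unique l_ge2 two_neq0 h (modMP C Psi2)).
Qed.

End ModuleFormulas.

(** * The Euler operator and linear maps commuting with the variables *)

Section Polynomials.

(** Euler's identity: monomials are eigenvectors of the Euler operator, with their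
degree as eigenvalue. *)
Lemma mcoeff_euler {R : comNzRingType} {n : nat} (f : {mpoly R[n]}) m :
  (\sum_k 'X_k * f^`M(k))@_m = (mdeg m)%:R * f@_m.
Proof.
elim/mpolyind: f => [|c m' f _ _ IHf].
  by rewrite big1 ?mcoeff0 ?mulr0 // => k _; rewrite raddf0 mulr0.
under eq_bigr => k _ do rewrite linearP mulrDr -scalerAr.
rewrite big_split /= mcoeffD IHf mcoeffD mulrDr; congr (_ + _).
rewrite -scaler_sumr !mcoeffZ mcoeffX.
have -> : \sum_k 'X_k * ('X_[m'])^`M(k) = (mdeg m')%:R *: 'X_[m'] :> {mpoly R[n]}.
  rewrite mdegE natr_sum scaler_suml; apply: eq_bigr => k _.
  rewrite mderivX -scalerAr -mpolyXD.
  have [->|mk_gt0] := posnP (m' k); first by rewrite !scale0r.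
  by rewrite addmC submK // lep1mP -lt0n.
rewrite mcoeffZ mcoeffX; case: eqP => [->|_]; last by rewrite !mulr0.
by rewrite mulrCA.
Qed.

Lemma linear_comm_vars_mulE {R : comNzRingType} {n : nat}
    (phi : {linear {mpoly R[n]} -> {mpoly R[n]}}) :
  (forall k f, phi ('X_k * f) = 'X_k * phi f) ->
  forall f, phi f = f * phi 1.
Proof.
move=> phiX f.
have phiXm m g : phi ('X_[m] * g) = 'X_[m] * phi g.
  rewrite mpolyXE_id; move: g.
  apply: (big_ind (fun h => forall g, phi (h * g) = h * phi g)).
  - by move=> g; rewrite !mul1r.
  - by move=> h1 h2 IH1 IH2 g; rewrite -!mulrA IH1 IH2.
  move=> k _ g; by elim: (m k) => [|e IHe]; rewrite ?mul1r // exprS -!mulrA phiX IHe.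
elim/mpolyind: f => [|c m f _ _ IHf]; first by rewrite raddf0 mul0r.
by rewrite linearP /= -['X_[m] in LHS]mulr1 phiXm IHf mulrDl scalerAl.
Qed.

Context {F : fieldType} {l : nat}.

Lemma pY_upair (p : upair l) :
  pY F (val p).1 (val p).2 = 'X_(enum_rank p) :> polyY F l.
Proof.
rewrite /pY /vY -surjective_pairing valK insubN ?subr0 //=.
by rewrite -leqNgt ltnW ?(valP p).
Qed.

Lemma dY_upair (p : upair l) (f : polyY F l) :
  dY (val p).1 (val p).2 f = f^`M(enum_rank p).
Proof.
rewrite /dY /dvY -surjective_pairing valK insubN ?subr0 //=.
by rewrite -leqNgt ltnW ?(valP p).
Qed.

(** In [tX i i f] the pairs [r < i] and [s > i] appear separately, so each
unordered pair of indices, i.e. each variable, is met twice. *)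
Lemma sum_tX_diag (f : polyY F l) :
  \sum_i tX i i f = 2 *: \sum_k 'X_k * f^`M(k).
Proof.
rewrite scaler_nat mulr2n.
have E : \sum_(i < l) \sum_(r < l | (r < i)%N) pY F r i * dY r i f
    = \sum_k 'X_k * f^`M(k).
  rewrite (exchange_big_dep predT) //= pair_big_dep /=.
  rewrite (big_sub (fun p : 'I_l * 'I_l => (p.1 < p.2)%N)
             (fun p => pY F p.1 p.2 * dY p.1 p.2 f)).
  rewrite (reindex_onto enum_rank enum_val) => [|k _]; last exact: enum_valK.
  apply: eq_big => [p|p _]; first by rewrite enum_rankK eqxx.
  by rewrite pY_upair dY_upair.
rewrite big_split /= {1}E; congr (_ + _).
rewrite -E (exchange_big_dep predT) //=; apply: eq_bigr.
Qed.

End Polynomials.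

(** * Isomorphisms between the modules *)

Lemma lie_actZr {F : fieldType} {n : nat} {g : {vspace 'M[F]_n}} {V : lmodType F}
    (rho : lie_module g V) A a v :
  A \in g -> rho A (a *: v) = a *: rho A v.
Proof.
move=> hA; have rho0 : rho A 0 = 0.
  by have := lie_actDr rho hA (-1) 0 0; rewrite scaler0 addr0 scaleN1r addNr.
by rewrite -[a *: v]addr0 lie_actDr // rho0 addr0.
Qed.

Lemma modM_iso_sufficient {F : numFieldType} {l : nat} (l_ge2 : (2 <= l)%N)
    (C c : F) (Psi1 Psi2 : polyY F l) :
  Psi1 - Psi2 = c%:MP -> lie_module_iso (modM C Psi1) (modM C Psi2).
Proof.
move=> dPsi; exists idfun; split=> [|A f hA /=]; first by exists id.
exact: modM_shift dPsi _ hA f.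
Qed.

(** Any isomorphism is a nonzero scalar: it is multiplication by a polynomial that
must be invertible because the constant 1 is in the image. *)
Lemma modM_iso_act_eq {F : numFieldType} {l : nat} (l_ge2 : (2 <= l)%N)
    (C1 C2 : F) (Psi1 Psi2 : polyY F l) :
  lie_module_iso (modM C1 Psi1) (modM C2 Psi2) ->
  forall A, A \in so2l F l -> forall f, modM C1 Psi1 A f = modM C2 Psi2 A f.
Proof.
move=> [phi [[psi phiK psiK] phi_act]].
have phiX k f : phi ('X_k * f) = 'X_k * phi f.
  have -> : 'X_k = pY F (val (enum_val k)).1 (val (enum_val k)).2.
    by rewrite pY_upair enum_valK.
  by rewrite -!(modM_Y l_ge2 C1 Psi1) phi_act ?mem_mxY // !modM_Y.
have phiE := linear_comm_vars_mulE phi phiX.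
have /andP[/eqP phi1E u_unit] : mpoly_unit (phi 1).
  by apply: (@mpoly_intro_unit _ _ _ (psi 1)); rewrite -phiE psiK.
move=> A hA f; apply: (scalerI (a := (phi 1)@_0)).
  by move: u_unit; rewrite unitfE.
have phiZ g : phi g = (phi 1)@_0 *: g.
  by rewrite -mul_mpolyC -phi1E mulrC -phiE.
by rewrite -phiZ phi_act // phiZ lie_actZr.
Qed.

(** [C] and [Psi] up to constants are determined by how the sum of the [X_ii] acts
on the constant polynomial 1. *)
Lemma modM_iso_necessary {F : numFieldType} {l : nat} (l_ge2 : (2 <= l)%N)
    (C1 C2 : F) (Psi1 Psi2 : polyY F l) :
  lie_module_iso (modM C1 Psi1) (modM C2 Psi2) ->
  C1 = C2 /\ exists c : F, Psi1 - Psi2 = c%:MP.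
Proof.
move=> /(modM_iso_act_eq l_ge2) actE.
have xcE i : xc C1 Psi1 i i = xc C2 Psi2 i i.
  have := actE _ (mem_mxX F i i) 1.
  by rewrite !modM_X // !mulr1 => /addIr.
have sum_xc C (Psi : polyY F l) m : (\sum_i xc C Psi i i)@_m =
    2 * (mdeg m)%:R * Psi@_m + l%:R * C * (m == 0%MM)%:R.
  rewrite big_split /= sum_tX_diag mcoeffD mcoeffZ mcoeff_euler mulrA.
  congr (_ + _); rewrite (eq_bigr (fun=> C%:MP)) => [|i _]; last by rewrite eqxx mul1r.
  by rewrite sumr_const card_ord mcoeffMn mcoeffC -[LHS]mulr_natl mulrA.
have coefE m : 2 * (mdeg m)%:R * Psi1@_m + l%:R * C1 * (m == 0%MM)%:R =
    2 * (mdeg m)%:R * Psi2@_m + l%:R * C2 * (m == 0%MM)%:R.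
  by rewrite -!sum_xc; congr (_@_m); apply: eq_bigr => i _.
split.
  have := coefE 0%MM; rewrite mdeg0 eqxx !mulr0 !mul0r !add0r !mulr1.
  by apply: mulfI; rewrite pnatr_eq0 -lt0n ltnW.
exists (Psi1 - Psi2)@_0; apply/mpolyP=> m; rewrite mcoeffC mcoeffB.
have [->|m_neq0] := eqVneq m 0%MM; first by rewrite mulr1 -mcoeffB.
have := coefE m; rewrite (negbTE m_neq0) !mulr0 !addr0 => /mulfI->.
  by rewrite subrr.
by rewrite -natrM pnatr_eq0 muln_eq0 mdeg_eq0.
Qed.

Theorem theorem4p7 (R : realType) (l : nat) (hl : (2 <= l)%N)
    (C1 C2 : R[i]) (Psi1 Psi2 : polyY R[i] l) :
  lie_module_iso (modM C1 Psi1) (modM C2 Psi2) <->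
  C1 = C2 /\ exists c : R[i], Psi1 - Psi2 = c%:MP.
Proof.
split=> [|[-> [c dPsi]]]; first exact: modM_iso_necessary.
exact: modM_iso_sufficient dPsi.
Qed.
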